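(* Let $X$ be a Banach space such that $X^*=\ell_1$ (isometrically). Suppose there exist a subsequence $\{e^*_{n_k}\}_{k\in\mathbb N}$ of the standard basis $\{e^*_n\}$ of $\ell_1$ and an element $e^*\in\ell_1$ such that $e^*_{n_k}\to e^*$ in the topology $\sigma(\ell_1,X)$ as $k\to\infty$, and $\mathrm{supp}(e^* )\subseteq\{n_k\}_{k\in\mathbb N}$. Then $X$ contains a $1$-complemented isometric copy of $W_\alpha$ with $\alpha=(e^*(n_1),e^*(n_2),\dots,e^*(n_k),\dots)$.
   Context: All spaces are real. The hypothesis $X^*=\ell_1$ means that a linear isometry of $X^*$ onto $\ell_1$ is fixed, and $\sigma(\ell_1,X)$ is the corresponding weak$^*$ topology on $\ell_1$. For $e^*=(e^*(1),e^*(2),\dots)\in\ell_1$, $\mathrm{supp}(e^* )=\{n\in\mathbb N: e^*(n)\ne0\}$. Let $c$ be the space of convergent real sequences with the supremum norm. For $\alpha=(\alpha(1),\alpha(2),\dots)\in\ell_1$ with $\|\alpha\|\le1$, $$W_\alpha=\left\{x=(x(1),x(2),\dots)\in c:\ \lim_{i\to\infty}x(i)=\sum_{i=1}^\infty\alpha(i)x(i)\right\}.$$ A subspace of $X$ is $1$-complemented if it is the range of a linear projection on $X$ of norm at most $1$; an isometric copy means the image of a linear isometric embedding. *)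

(* Defs.v *)
From HB Require Import structures.
From mathcomp Require Import all_boot all_order all_algebra.
From mathcomp Require Import all_classical all_reals all_analysis.

Set Implicit Arguments.
Unset Strict Implicit.
Unset Printing Implicit Defensive.

Import Order.TTheory GRing.Theory Num.Theory.
Import numFieldNormedType.Exports.

Local Open Scope classical_set_scope.
Local Open Scope ring_scope.

(* Sequences are indexed from 0: the coordinate u(n) of the literature, n >= 1,
   is [u n.-1]. *)

Section ell1.
Context {R : realType}.

Definition ell1_pred : {pred nat -> R} :=
  mem [set u : nat -> R | cvgn (series (fun n => `|u n|))].

Lemma ell1_submod_closed : submod_closed ell1_pred.
Proof.
split.
  rewrite inE /= (_ : series _ = cst 0); first exact: is_cvg_cst.
  by apply/funext => n; rewrite /series/= big1// => i _; rewrite normr0.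
move=> a u v; rewrite !inE /= => cu cv.
apply: (@series_le_cvg _ _ ((fun n => `|a| * `|u n|) + (fun n => `|v n|))).
- by move=> n; exact: normr_ge0.
- by move=> n; rewrite addr_ge0// mulr_ge0.
- by move=> n; rewrite (le_trans (ler_normD _ _))// normrZ.
- apply: is_cvg_seriesD => //.
  exact: (@is_cvg_seriesZ R (fun n => `|u n|) `|a|).
Qed.

HB.instance Definition _ :=
  GRing.isSubmodClosed.Build R (nat -> R) ell1_pred ell1_submod_closed.

Record ell1 := Ell1 { ell1_val :> nat -> R; ell1P : ell1_val \in ell1_pred }.

HB.instance Definition _ := [isSub for ell1_val].
HB.instance Definition _ := [Choice of ell1 by <:].
HB.instance Definition _ := [SubChoice_isSubLmodule of ell1 by <:].

Lemma ell1_summable (u : ell1) : cvgn (series (fun n => `|u n|)).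
Proof. by have := ell1P u; rewrite inE. Qed.

Definition ell1_norm (u : ell1) : R := limn (series (fun n => `|u n|)).

Lemma ell1_norm_ge (u : ell1) n : \sum_(0 <= k < n) `|u k| <= ell1_norm u.
Proof.
have nd : nondecreasing_seq (series (fun k => `|u k|)); last first.
  exact: (nondecreasing_cvgn_le nd (@ell1_summable u) n).
move=> i j ij; rewrite /series /=.
by rewrite (big_cat_nat (leq0n _) ij)//= lerDl sumr_ge0.
Qed.

Lemma ell1_normD u v : ell1_norm (u + v) <= ell1_norm u + ell1_norm v.
Proof.
rewrite /ell1_norm -lim_seriesD; [|exact: ell1_summable..].
apply: lim_series_le => [||n]; first exact: ell1_summable.
  by apply: is_cvg_seriesD; exact: ell1_summable.
exact: ler_normD.
Qed.

Lemma ell1_normZ (a : R) u : ell1_norm (a *: u) = `|a| * ell1_norm u.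
Proof.
rewrite /ell1_norm -[RHS](@lim_seriesZ R (fun n => `|u n|)); last first.
  exact: ell1_summable.
by congr (limn (series _)); apply/funext => n; rewrite normrZ.
Qed.

Lemma ell1_norm_eq0 u : ell1_norm u = 0 -> u = 0.
Proof.
move=> u0; apply/val_inj/funext => n; apply/normr0_eq0/le_anti.
rewrite normr_ge0 andbT -u0 (le_trans _ (ell1_norm_ge u n.+1))//.
by rewrite big_nat_recr//= lerDr sumr_ge0.
Qed.

HB.instance Definition _ :=
  Lmodule_isNormed.Build R ell1 ell1_normD ell1_normZ ell1_norm_eq0.

Definition supp (u : ell1) : set nat := [set n | u n != 0].

Fact ell1_basis_subproof n : (fun k => (k == n)%:R : R) \in ell1_pred.
Proof.
rewrite inE /=; apply: (cvgP (1 : R)); apply: cvg_near_cst; near=> m.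
have nm : (n < m)%N by near: m; exact: nbhs_infty_gt.
rewrite /series /= (bigD1_seq n) ?mem_index_iota ?iota_uniq//=.
by rewrite eqxx normr1 big1 ?addr0// => i /negPf ->; rewrite normr0.
Unshelve. all: by end_near. Qed.

Definition ell1_basis n : ell1 := Ell1 (ell1_basis_subproof n).

Fact ell1_subseq_subproof (n : nat -> nat) (n_incr : increasing_seq n)
  (u : ell1) : u \o n \in ell1_pred.
Proof.
rewrite inE /=; apply: nondecreasing_is_cvgn.
  move=> i j ij; rewrite /series /=.
  by rewrite (big_cat_nat (leq0n _) ij)//= lerDl sumr_ge0.
exists (ell1_norm u) => _ [m _ <-].
rewrite (le_trans _ (ell1_norm_ge u (n m)))// /series /=.
elim: m => [|m IHm]; first by rewrite big_geq// sumr_ge0.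
have nm : (n m < n m.+1)%N.
  by have := n_incr m.+1 m; rewrite ltnn ltnNge -leEnat => ->.
rewrite big_nat_recr//= (big_cat_nat (leq0n _) (ltnW nm))//=.
by rewrite lerD// (big_ltn nm) lerDl sumr_ge0.
Qed.

Definition ell1_subseq (n : nat -> nat) (n_incr : increasing_seq n)
  (u : ell1) : ell1 := Ell1 (ell1_subseq_subproof n_incr u).

End ell1.
Arguments ell1 R : clear implicits.

Section dual.
Context {R : realType} {X : normedModType R}.

Definition dual_pred : {pred X -> R} :=
  mem [set f : X -> R | scalar f /\ continuous f].

Lemma dual_submod_closed : submod_closed dual_pred.
Proof.
split.
  rewrite inE; split=> [a u v|]; last exact: cst_continuous.
  by rewrite mulr0 addr0.
move=> a f g; rewrite !inE => -[lf cf] [lg cg]; split=> [b u v|x].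
  rewrite !fctE/= lf lg /GRing.scale/= !mulrDr !mulrA [b * a]mulrC.
  by rewrite addrACA.
by apply: cvgD; [apply: cvgZl_tmp; exact: cf|exact: cg].
Qed.

HB.instance Definition _ :=
  GRing.isSubmodClosed.Build R (X -> R) dual_pred dual_submod_closed.

Record dual := Dual { dual_val :> X -> R; dualP : dual_val \in dual_pred }.

HB.instance Definition _ := [isSub for dual_val].
HB.instance Definition _ := [Choice of dual by <:].
HB.instance Definition _ := [SubChoice_isSubLmodule of dual by <:].

Lemma dual_scalar (f : dual) : scalar f.
Proof. by have := dualP f; rewrite inE => -[]. Qed.

Lemma dual_continuous (f : dual) : continuous f.
Proof. by have := dualP f; rewrite inE => -[]. Qed.

Definition dual_norm (f : dual) : R :=
  sup [set `|f x| | x in [set x : X | `|x| <= 1]].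

Lemma dual0 (f : dual) : f 0 = 0.
Proof.
have := @dual_scalar f (- 1) 0 0.
by rewrite scaler0 add0r mulN1r addNr.
Qed.

Lemma dualZ (f : dual) a x : f (a *: x) = a * f x.
Proof. by rewrite -[a *: x]addr0 dual_scalar dual0 addr0. Qed.

Lemma dual_has_sup (f : dual) :
  has_sup [set `|f x| | x in [set x : X | `|x| <= 1]].
Proof.
split; first by exists `|f 0|, 0 => //=; rewrite normr0.
pose L : GRing.isLinear R X R *%R f :=
  GRing.isLinear.Build R X R *%R f (dual_scalar f).
pose F : {linear X -> R} := HB.pack (f : X -> R) L.
have /(linear_bounded_continuous F)/(bounded_funP F)/(_ 1) [M FM] :
  continuous F by exact: dual_continuous.
by exists M => _ [x x1 <-]; exact: FM.
Qed.

Lemma dual_norm_le (f : dual) M :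
  (forall x, `|x| <= 1 -> `|f x| <= M) -> dual_norm f <= M.
Proof.
move=> fM; apply: ge_sup; first by have [] := dual_has_sup f.
by move=> _ [x x1 <-]; exact: fM.
Qed.

Lemma dual_norm_ge (f : dual) x : `|x| <= 1 -> `|f x| <= dual_norm f.
Proof. by move=> x1; apply: (ub_le_sup (dual_has_sup f).2); exists x. Qed.

Lemma dual_normD f g : dual_norm (f + g) <= dual_norm f + dual_norm g.
Proof.
apply: dual_norm_le => x x1; rewrite (le_trans (ler_normD _ _))//.
by rewrite lerD// dual_norm_ge.
Qed.

Lemma dual_normZ (a : R) f : dual_norm (a *: f) = `|a| * dual_norm f.
Proof.
have le_normZ b g : dual_norm (b *: g) <= `|b| * dual_norm g.
  apply: dual_norm_le => x x1.
  by rewrite normrZ ler_wpM2l// dual_norm_ge.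
apply/le_anti; rewrite le_normZ /=; have [->|a0] := eqVneq a 0.
  rewrite normr0 mul0r (le_trans _ (dual_norm_ge (x := 0) _ _)) ?normr0//.
rewrite -ler_pdivlMl ?normr_gt0// -normfV (le_trans _ (le_normZ _ _))//.
by rewrite scalerA mulVf// scale1r.
Qed.

Lemma dual_norm_eq0 f : dual_norm f = 0 -> f = 0.
Proof.
move=> f0; apply/val_inj/funext => x; apply/normr0_eq0.
rewrite -[\val f x]/(f x).
have [->|x0] := eqVneq x 0; first by rewrite dual0 normr0.
have : `|f (`|x|^-1 *: x)| <= 0.
  by rewrite -f0 dual_norm_ge// normrZ normfV normr_id mulVf// normr_eq0.
by rewrite dualZ normrM pmulr_rle0 ?normr_gt0 ?invr_eq0 ?normr_eq0//
  normr_le0 => /eqP ->; rewrite normr0.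
Qed.

HB.instance Definition _ :=
  Lmodule_isNormed.Build R dual dual_normD dual_normZ dual_norm_eq0.

Definition weak_star : Type :=
  initial_topology (dual_val : dual -> {ptws X -> R}).
HB.instance Definition _ := Topological.on weak_star.

End dual.
Arguments dual {R} X.
Arguments weak_star {R} X.

(* The topology sigma(ell1, X): for a bijection J, y_k --> y iff
   (J^-1 y_k) x --> (J^-1 y) x for all x in X. *)
Definition sigma_ell1 {R : realType} {X : normedModType R}
    (J : dual X -> ell1 R) : Type :=
  initial_topology ('pinv_(fun=> 0) setT J : ell1 R -> weak_star X).
HB.instance Definition _ {R : realType} {X : normedModType R}
  (J : dual X -> ell1 R) := Topological.on (sigma_ell1 J).

Section isometry.
Context {R : realType}.
Implicit Types V W X : normedModType R.

Definition isometric V W (T : V -> W) := forall v, `|T v| = `|v|.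

(* The bound is stated pointwise because [sup] of an unbounded set is 0, so that
   a formula for the operator norm would not entail boundedness. *)
Definition contains_one_complemented_copy X W :=
  exists2 T : {linear W -> X}, isometric T &
  exists P : {linear X -> X},
    [/\ P \o P = P, (forall x, `|P x| <= `|x|) & range P = range T].

End isometry.

Section cseq.
Context {R : realType}.

Definition cseq_pred : {pred nat -> R} := mem [set x : nat -> R | cvgn x].

Lemma cseq_submod_closed : submod_closed cseq_pred.
Proof.
split; first by rewrite inE; exact: is_cvg_cst.
move=> a u v; rewrite !inE /= => cu cv.
by apply: is_cvgD => //; exact: is_cvgZl_tmp.
Qed.

HB.instance Definition _ :=
  GRing.isSubmodClosed.Build R (nat -> R) cseq_pred cseq_submod_closed.

Record cseq := CSeq { cseq_val :> nat -> R; cseqP : cseq_val \in cseq_pred }.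

HB.instance Definition _ := [isSub for cseq_val].
HB.instance Definition _ := [Choice of cseq by <:].
HB.instance Definition _ := [SubChoice_isSubLmodule of cseq by <:].

Lemma cseq_cvg (x : cseq) : cvgn x.
Proof. by have := cseqP x; rewrite inE. Qed.

Definition cseq_norm (x : cseq) : R := sup (range (fun n => `|x n|)).

Lemma cseq_has_sup (x : cseq) : has_sup (range (fun n => `|x n|)).
Proof.
split; first by exists `|x 0%N|, 0%N.
have [M [_ xM]] := cvg_seq_bounded (@cseq_cvg x).
by exists (M + 1) => _ [n _ <-]; apply: (xM (M + 1)) => //; rewrite ltrDl.
Qed.

Lemma cseq_norm_le (x : cseq) M : (forall n, `|x n| <= M) -> cseq_norm x <= M.
Proof.
move=> xM; apply: ge_sup; first by have [] := cseq_has_sup x.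
by move=> _ [n _ <-].
Qed.

Lemma cseq_norm_ge (x : cseq) n : `|x n| <= cseq_norm x.
Proof. by apply: (ub_le_sup (cseq_has_sup x).2); exists n. Qed.

Lemma cseq_normD x y : cseq_norm (x + y) <= cseq_norm x + cseq_norm y.
Proof.
apply: cseq_norm_le => n; rewrite (le_trans (ler_normD _ _))//.
by rewrite lerD// cseq_norm_ge.
Qed.

Lemma cseq_normZ (a : R) x : cseq_norm (a *: x) = `|a| * cseq_norm x.
Proof.
have le_normZ b y : cseq_norm (b *: y) <= `|b| * cseq_norm y.
  by apply: cseq_norm_le => n; rewrite normrZ ler_wpM2l// cseq_norm_ge.
apply/le_anti; rewrite le_normZ /=; have [->|a0] := eqVneq a 0.
  by rewrite normr0 mul0r (le_trans _ (cseq_norm_ge _ 0%N)).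
rewrite -ler_pdivlMl ?normr_gt0// -normfV (le_trans _ (le_normZ _ _))//.
by rewrite scalerA mulVf// scale1r.
Qed.

Lemma cseq_norm_eq0 x : cseq_norm x = 0 -> x = 0.
Proof.
move=> x0; apply/val_inj/funext => n; apply/normr0_eq0/le_anti.
by rewrite normr_ge0 andbT -x0 cseq_norm_ge.
Qed.

HB.instance Definition _ :=
  Lmodule_isNormed.Build R cseq cseq_normD cseq_normZ cseq_norm_eq0.

End cseq.
Arguments cseq R : clear implicits.

(* The usual restriction `|alpha| <= 1 plays no role in the definition. *)
Section W.
Context {R : realType} (alpha : ell1 R).

Definition W_pred : {pred cseq R} :=
  mem [set x : cseq R | limn x = limn (series (fun i => alpha i * x i))].

Lemma W_summable (x : cseq R) : cvgn (series (fun i => alpha i * x i)).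
Proof.
apply: normed_cvg.
apply: (@series_le_cvg _ _ (fun i => cseq_norm x * `|alpha i|)).
- by move=> n; exact: normr_ge0.
- by move=> n; rewrite mulr_ge0// (le_trans _ (cseq_norm_ge x 0%N)).
- by move=> n; rewrite /= normrM mulrC ler_wpM2r// cseq_norm_ge.
- exact: (@is_cvg_seriesZ R (fun n => `|alpha n|) _ (@ell1_summable _ alpha)).
Qed.

Lemma W_submod_closed : submod_closed W_pred.
Proof.
split.
  rewrite inE /=.
  have -> : series (fun i => alpha i * (0 : cseq R) i) = cst 0.
    by apply/funext => n; rewrite /series /= big1// => i _; rewrite mulr0.
  by rewrite lim_cst// -[RHS](@lim_cst R _ nat \oo).
move=> a x y; rewrite !inE /= => lx ly.
have cx := @cseq_cvg _ x; have cy := @cseq_cvg _ y.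
have -> : limn (a *: x + y : cseq R) = a *: limn x + limn y.
  rewrite -limZl_tmp// -limD//; exact: is_cvgZl_tmp.
rewrite lx ly -(lim_seriesZ a (@W_summable x)) -lim_seriesD; last 2 first.
  exact: is_cvg_seriesZ (@W_summable x).
  exact: W_summable.
congr (limn (series _)); apply/funext => i /=.
by rewrite !fctE mulrDr mulrCA.
Qed.

HB.instance Definition _ :=
  GRing.isSubmodClosed.Build R (cseq R) W_pred W_submod_closed.

Record W := MkW { W_val :> cseq R; W_P : W_val \in W_pred }.

HB.instance Definition _ := [isSub for W_val].
HB.instance Definition _ := [Choice of W by <:].
HB.instance Definition _ := [SubChoice_isSubLmodule of W by <:].

Definition W_norm (x : W) : R := `|W_val x|.

Lemma W_normD x y : W_norm (x + y) <= W_norm x + W_norm y.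
Proof. exact: ler_normD. Qed.

Lemma W_normZ (a : R) x : W_norm (a *: x) = `|a| * W_norm x.
Proof. exact: normrZ. Qed.

Lemma W_norm_eq0 x : W_norm x = 0 -> x = 0.
Proof. by move=> /normr0_eq0 x0; exact/val_inj. Qed.

HB.instance Definition _ :=
  Lmodule_isNormed.Build R W W_normD W_normZ W_norm_eq0.

End W.

(* Main.v *)
(* Write h_k = J^-1 e_{n_k}.  Coordinates x |-> (h_k x)_k map X contractively into
   W_alpha, because h_k --> J^-1 e^* pointwise and supp e^* lies in {n_k}; so it
   suffices to find a linear isometric right inverse T : W_alpha -> X of this map.

   T is the limit of w |-> U_m w = sum_{j < m} w_j x_{m,j}, where h_k x_{m,j} =
   delta_{kj} for k, j < m, and U_m has norm at most 1 + eps_m on the sup-normed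
   R^m.  The stages are chosen so that U_{m+1} (h (U_m w)) is close to U_m w.  In
   the bidual ell_infty of X such a next stage is written down coordinatewise, and
   a principle of local reflexivity, obtained from Hahn-Banach and the expansion of
   functionals along J^-1 e_i, brings it down to X.

   That U_m w converges for w in W_alpha is a gliding hump argument: the error
   w - h (U_m w) vanishes below m and is small far out (this is where w in W_alpha
   is used), but may be large in between; averaging U_m w over well spaced m makes
   the error uniformly small. *)
From HB Require Import structures.
Require Import Defs.
From mathcomp Require Import all_boot all_order all_algebra.
From mathcomp Require Import all_classical all_reals all_analysis.
From mathcomp Require Import ring lra zify.
Import Order.TTheory GRing.Theory Num.Theory.
Import numFieldNormedType.Exports.
Local Open Scope classical_set_scope.
Local Open Scope ring_scope.

(** * Hahn-Banach *)

Section hahn_banach.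
Context (R : realType) (V : lmodType R) (p : V -> R)
  (pD : forall u v, p (u + v) <= p u + p v)
  (pZ : forall a u, 0 < a -> p (a *: u) = a * p u).

(** A linear functional on a subspace, encoded as a graph. Single-valuedness follows from
    domination: if [(0, r)] and [(0, - r)] lie in [G], then [r = 0] because [p 0 = 0]. *)
Definition dominated_graph (G : set (V * R)) :=
  [/\ G (0, 0),
      forall a u r v s, G (u, r) -> G (v, s) -> G (a *: u + v, a * r + s) &
      forall u r, G (u, r) -> r <= p u].

(** A value [c] at [v] is admissible when [r - p (u - v) <= c <= p (u + v) - r] for all [(u, r)] in
    [G]. Subadditivity puts every lower bound below every upper bound, so the supremum of the lower
    bounds works. *)
Lemma dominated_graph_extend (G : set (V * R)) (v : V) : dominated_graph G ->
  exists2 G', dominated_graph G' & G `<=` G' /\ exists r, G' (v, r).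
Proof.
move=> [G0 Glin Gp].
pose A := [set z | exists u r, G (u, r) /\ z = r - p (u - v)].
have Aub u r : G (u, r) -> ubound A (p (u + v) - r).
  move=> Gur _ [u' [r' [Gur' ->]]].
  have := Gp _ _ (Glin 1 _ _ _ _ Gur Gur'); rewrite scale1r mul1r => h.
  have := pD (u + v) (u' - v); rewrite addrACA subrr addr0; lra.
have hA : has_sup A.
  by split; [exists (0 - p (0 - v)), 0, 0 | exists (p (0 + v) - 0); exact: Aub].
pose c := sup A.
have c_ge u r : G (u, r) -> r - p (u - v) <= c.
  by move=> Gur; apply: (ub_le_sup hA.2); exists u, r.
have c_le u r : G (u, r) -> c <= p (u + v) - r.
  by move=> Gur; apply: ge_sup; [exact: hA.1|exact: Aub].
have GZ a u r : G (u, r) -> G (a *: u, a * r).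
  by move=> Gur; have := Glin a _ _ _ _ Gur G0; rewrite !addr0.
exists [set z | exists u r t, G (u, r) /\ z = (u + t *: v, r + t * c)].
  split.
  - by exists 0, 0, 0; rewrite scale0r mul0r !addr0.
  - move=> a _ _ _ _ [u [r [t [Gur [-> ->]]]]] [u' [r' [t' [Gur' [-> ->]]]]].
    exists (a *: u + u'), (a * r + r'), (a * t + t'); split; first exact: Glin.
    congr pair; last by ring.
    by rewrite scalerDr scalerA scalerDl addrACA.
  - move=> _ _ [u [r [t [Gur [-> ->]]]]].
    have [t0|t0|->] := ltgtP t 0; last by rewrite scale0r mul0r !addr0 Gp.
    + have nt0 : 0 < - t by rewrite oppr_gt0.
      have := c_ge _ _ (GZ (- t)^-1 _ _ Gur).
      rewrite -(ler_pM2l nt0) mulrBr -(pZ _ _ nt0) scalerBr scalerA mulrA.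
      rewrite mulfV ?gt_eqF// scale1r mul1r scaleNr opprK; lra.
    + have := c_le _ _ (GZ t^-1 _ _ Gur).
      rewrite -(ler_pM2l t0) mulrBr -(pZ _ _ t0) scalerDr scalerA mulrA.
      by rewrite mulfV ?gt_eqF// scale1r mul1r; lra.
split.
  by move=> [u r] Gur; exists u, r, 0; rewrite scale0r mul0r !addr0.
by exists c, 0, 0, 1; rewrite !add0r scale1r mul1r.
Qed.

Theorem hahn_banach (G0 : set (V * R)) : dominated_graph G0 ->
  exists f : V -> R, [/\ scalar f, forall v, f v <= p v &
    forall v r, G0 (v, r) -> f v = r].
Proof.
move=> dG0.
pose P (A : set (V * R)) := A = set0 \/ (dominated_graph A /\ G0 `<=` A).
have [|G [PG Gmax]] := @Zorn_bigcup _ P.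
  move=> F FP Ftot.
  have [[A FA [a Aa]]|F0] := pselect (exists2 A, F A & A !=set0); last first.
    left; apply/seteqP; split=> // z [A FA Az].
    by apply: F0; exists A => //; exists z.
  have FG B z : F B -> B z -> dominated_graph B /\ G0 `<=` B.
    by move=> FB Bz; have [B0|//] := FP _ FB; rewrite B0 in Bz.
  have [[A0 Al Ap] G0A] := FG _ _ FA Aa.
  right; split; last by move=> z /G0A Az; exists A.
  split; first by exists A.
  - move=> t u r v s [B FB Bur] [C FC Cvs].
    have [[_ Bl _] _] := FG _ _ FB Bur; have [[_ Cl _] _] := FG _ _ FC Cvs.
    have [BC|CB] := Ftot _ _ FB FC.
      by exists C => //; apply: Cl => //; exact: BC.
    by exists B => //; apply: Bl => //; exact: CB.
  - by move=> u r [B FB Bur]; have [[_ _ Bp] _] := FG _ _ FB Bur; exact: Bp.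
have [dG G0G] : dominated_graph G /\ G0 `<=` G.
  case: PG => // G_0; have [z00 _ _] := dG0.
  exfalso; apply: (Gmax G0); last by right; split.
  by rewrite G_0; split=> // /(_ _ z00).
have Gtot v : exists r, G (v, r).
  have [G' dG' [GG' [r G'r]]] := dominated_graph_extend G v dG.
  exists r; apply: contrapT => nG; apply: (Gmax G').
    by split=> // /(_ _ G'r).
  by right; split => // z /G0G /GG'.
have [f Gf] := choice Gtot; have [G00 Gl Gp] := dG.
have Gfun v r : G (v, r) -> f v = r.
  move=> Gvr; have h1 := Gl (-1) _ _ _ _ Gvr (Gf v).
  have h2 := Gl (-1) _ _ _ _ (Gf v) Gvr.
  have p0 : p 0 = 0.
    by have := pZ 2 0 ltac:(lra); rewrite scaler0; lra.
  by have := Gp _ _ h1; have := Gp _ _ h2; rewrite !scaleN1r !addNr p0; lra.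
exists f; split.
- by move=> a u v; apply: Gfun; exact: Gl.
- by move=> v; exact: Gp.
- by move=> v r /G0G; exact: Gfun.
Qed.

End hahn_banach.

(** * The dual of an ell1 predual *)

Section ell1_dual_theory.
Context {R : realType}.

Lemma ell1_subE (u v : ell1 R) k : (u - v) k = u k - v k.
Proof. by []. Qed.

Lemma ell1_scaleE a (u : ell1 R) k : (a *: u) k = a * u k.
Proof. by []. Qed.

Lemma ell1_sumE (I : Type) (r : seq I) (F : I -> ell1 R) k :
  (\sum_(i <- r) F i) k = \sum_(i <- r) F i k.
Proof. exact: (big_morph (fun u : ell1 R => u k)). Qed.

Lemma ell1_norm_le (u : ell1 R) M :
  (forall N, \sum_(0 <= k < N) `|u k| <= M) -> `|u| <= M.
Proof.
move=> uM; apply: limr_le; first exact: ell1_summable.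
by apply: nearW => N; exact: uM.
Qed.

Lemma ell1_norm_cvg (u : ell1 R) :
  series (fun k => `|u k|) @ \oo --> `|u|.
Proof. exact: ell1_summable. Qed.

Context {X : normedModType R}.
Implicit Types phi : dual X.

Lemma dual_subE phi psi x : (phi - psi) x = phi x - psi x.
Proof. by []. Qed.

Lemma dual_scaleE a phi x : (a *: phi) x = a * phi x.
Proof. by []. Qed.

Lemma dual_sumE (I : Type) (r : seq I) (F : I -> dual X) x :
  (\sum_(i <- r) F i) x = \sum_(i <- r) F i x.
Proof. exact: (big_morph (fun u : dual X => u x)). Qed.

Lemma dualD phi x y : phi (x + y) = phi x + phi y.
Proof. by have := dual_scalar phi 1 x y; rewrite scale1r mul1r. Qed.

Lemma dualN phi x : phi (- x) = - phi x.
Proof. by rewrite -scaleN1r dualZ mulN1r. Qed.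

Lemma dualB phi x y : phi (x - y) = phi x - phi y.
Proof. by rewrite dualD dualN. Qed.

Lemma dual_sum phi (I : Type) (r : seq I) (F : I -> X) :
  phi (\sum_(i <- r) F i) = \sum_(i <- r) phi (F i).
Proof. exact: (big_morph phi (dualD phi) (dual0 phi)). Qed.

Lemma dual_le_norm phi x : `|phi x| <= `|phi| * `|x|.
Proof.
have [->|x0] := eqVneq x 0; first by rewrite dual0 !normr0 mulr0.
have nx : 0 < `|x| by rewrite normr_gt0.
have := @dual_norm_ge _ _ phi (`|x|^-1 *: x).
rewrite normrZ normfV normr_id mulVf ?gt_eqF// lexx => /(_ isT).
by rewrite dualZ normrM normfV normr_id ler_pdivrMl// mulrC.
Qed.

Lemma bounded_dual (g : X -> R) M :
  scalar g -> (forall x, `|g x| <= M * `|x|) -> exists phi, forall x, phi x = g x.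
Proof.
move=> gl gM.
pose L : GRing.isLinear R X R *%R g := GRing.isLinear.Build R X R *%R g gl.
pose G : {linear X -> R} := HB.pack (g : X -> R) L.
have gc : continuous G.
  apply/linear_bounded_continuous/bounded_funP => r; exists (`|M| * `|r|) => x xr.
  rewrite (le_trans (gM x))// (le_trans (ler_norm _))// normrM normr_id.
  by rewrite ler_wpM2l// (le_trans xr)// ler_norm.
have gD : g \in @dual_pred R X by rewrite inE.
by exists (Dual gD).
Qed.

Context (J : {linear dual X -> ell1 R}) (J_isometric : isometric J).

Context (f : nat -> dual X) (Jf : forall n, J (f n) = ell1_basis n).

Lemma predual_basis_norm n : `|f n| <= 1.
Proof.
rewrite -J_isometric Jf; apply: ell1_norm_le => N.
have [nN|Nn] := ltnP n N.
  rewrite (bigD1_seq n) ?mem_index_iota ?iota_uniq//= eqxx normr1 big1 ?addr0//.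
  by move=> i /negPf ->; rewrite normr0.
rewrite big_nat big1// => i /andP[_ iN]; rewrite /ell1_basis /=.
by rewrite ltn_eqF ?normr0// (leq_trans iN).
Qed.

Lemma predual_basis_le n x : `|f n x| <= `|x|.
Proof.
by rewrite (le_trans (dual_le_norm _ _))// ler_piMl// predual_basis_norm.
Qed.

(** As [J] is isometric, the remainder [psi N] of the expansion has norm at most the tail of the
    ell1 norm of [J phi], which tends to 0. *)
Lemma dual_expansion phi x :
  series (fun n => J phi n * f n x) @ \oo --> phi x.
Proof.
pose psi N := phi - \sum_(0 <= n < N) J phi n *: f n.
have Jpsi N : `|psi N| <= `|J phi| - \sum_(0 <= n < N) `|J phi n|.
  rewrite -J_isometric; apply: ell1_norm_le => M.
  have JpsiE k : J (psi N) k = if (k < N)%N then 0 else J phi k.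
    have -> : J (psi N) = J phi - \sum_(0 <= n < N) J phi n *: ell1_basis n.
      rewrite /psi raddfB raddf_sum /=; congr (_ - _).
      by apply: eq_bigr => n _; rewrite linearZ Jf.
    rewrite ell1_subE ell1_sumE.
    case: ltnP => kN.
      rewrite (bigD1_seq k) ?mem_index_iota ?iota_uniq//.
      rewrite ell1_scaleE /= eqxx mulr1 big1 ?addr0 ?subrr// => i ik.
      by rewrite -[LHS]/(J phi i * (k == i)%:R) eq_sym (negPf ik) mulr0.
    rewrite big_nat big1 ?subr0// => i /andP[_ iN].
    by rewrite ell1_scaleE /= gtn_eqF ?mulr0// (leq_trans iN).
  have le0N : \sum_(0 <= k < N) `|J (psi N) k| = 0.
    by rewrite big_nat big1// => k /andP[_ kN]; rewrite JpsiE kN normr0.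
  have [MN|NM] := leqP M N.
    rewrite big_nat big1 ?subr_ge0; first exact: ell1_norm_ge.
    by move=> k /andP[_ kM]; rewrite JpsiE (leq_trans kM MN) normr0.
  rewrite (big_cat_nat (leq0n N) (ltnW NM))/= le0N add0r lerBrDr addrC.
  rewrite (le_trans _ (ell1_norm_ge (J phi) M))//.
  rewrite [leRHS](big_cat_nat (leq0n N) (ltnW NM))/= lerD2l !big_nat.
  by apply: ler_sum => k /andP[Nk _]; rewrite JpsiE ltnNge Nk.
apply/cvgrPdist_le => e e0.
have := @ell1_norm_cvg (J phi) => /cvgrPdist_le /(_ (e / (1 + `|x|))).
have x1 : 0 < 1 + `|x| by rewrite ltr_pwDl.
move=> /(_ (divr_gt0 e0 x1)); apply: filterS => N /= hN.
have -> : phi x - series (fun n => J phi n * f n x) N = psi N x.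
  rewrite /psi dual_subE dual_sumE.
  by congr (_ - _); apply: eq_bigr => n _.
rewrite (le_trans (dual_le_norm _ _))//.
rewrite (@le_trans _ _ (e / (1 + `|x|) * `|x|))//.
  rewrite ler_wpM2r// (le_trans (Jpsi N))// (le_trans _ hN)//; exact: ler_norm.
rewrite mulrAC ler_pdivrMr// ler_wpM2l ?ltW//; lra.
Qed.

End ell1_dual_theory.

(** * Local reflexivity *)

Lemma dual_norm_adherent {R : realType} {X : normedModType R} (phi : dual X)
  (e : R) : 0 < e -> exists x, `|x| <= 1 /\ `|phi| - e < phi x.
Proof.
move=> e0; have [_ [x x1 <-] h] := sup_adherent e0 (dual_has_sup phi).
have [px|px] := leP 0 (phi x).
  by exists x; split=> //; rewrite ger0_norm in h.
exists (- x); rewrite normrN; split=> //.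
by rewrite dualN; rewrite ltr0_norm in h.
Qed.

Section weighted_max.
Context {R : realType} {X : normedModType R} {S : finType} (r : S -> R)
  (r0 : forall s, 0 < r s).

(** The norm on the finite power of [X] whose unit ball is the product of the balls of radius [r s];
    it turns a system of inequalities into a single one. *)
Definition weighted_max (v : S -> X) : R :=
  \big[Num.max/0]_s (`|v s| / r s).

Lemma weighted_max_ge0 v : 0 <= weighted_max v.
Proof. exact: bigmax_ge_id. Qed.

Lemma weighted_max_ge v s : `|v s| <= weighted_max v * r s.
Proof. by rewrite -ler_pdivrMr//; exact: (le_bigmax _ (fun s => `|v s| / r s)). Qed.

Lemma weighted_max_le v M : 0 <= M -> (forall s, `|v s| <= M * r s) ->
  weighted_max v <= M.
Proof. by move=> M0 vM; apply: bigmax_le => // s _; rewrite ler_pdivrMr. Qed.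

Lemma weighted_maxD u v :
  weighted_max (u + v) <= weighted_max u + weighted_max v.
Proof.
apply: weighted_max_le => [|s]; first by rewrite addr_ge0// weighted_max_ge0.
by rewrite (le_trans (ler_normD _ _))// mulrDl lerD// weighted_max_ge.
Qed.

Lemma weighted_maxZ a v : 0 < a -> weighted_max (a *: v) = a * weighted_max v.
Proof.
have leZ b u : 0 < b -> weighted_max (b *: u) <= b * weighted_max u.
  move=> b0; apply: weighted_max_le => [|s].
    by rewrite mulr_ge0 ?weighted_max_ge0 ?ltW.
  by rewrite normrZ gtr0_norm// -mulrA ler_pM2l// weighted_max_ge.
move=> a0; apply/le_anti; rewrite leZ//= -ler_pdivlMl//.
rewrite (le_trans _ (leZ _ _ _)) ?invr_gt0//.
by rewrite scalerA mulVf ?gt_eqF// scale1r.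
Qed.

End weighted_max.

Section local_reflexivity.
Context {R : realType} {X : normedModType R}.
Context (J : {linear dual X -> ell1 R}) (J_isometric : isometric J).
Context (f : nat -> dual X) (Jf : forall n, J (f n) = ell1_basis n).

(* [xi j], read along the basis of ell1, stands for an element of the bidual; a
   finite system of norm inequalities that it solves is almost solved in X, with
   the prescribed values of the functionals [f (nu k)] attained exactly. *)
Theorem local_reflexivity (I S : finType) (nu : I -> nat) (y : I -> X)
    (c : S -> I -> R) (b : S -> X) (r : S -> R) (xi : I -> nat -> R) (K : R) :
  (forall k j, f (nu k) (y j) = (k == j)%:R) ->
  (forall k j, xi j (nu k) = (k == j)%:R) ->
  (forall s, 0 < r s) -> 1 < K ->
  (forall s n, `|\sum_j c s j * xi j n - f n (b s)| <= r s) ->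
  exists x : I -> X, (forall k j, f (nu k) (x j) = (k == j)%:R) /\
    forall s, `|\sum_j c s j *: x j - b s| <= K * r s.
Proof.
move=> fy fxi r0 K1 xiP; apply: contrapT => nex.
have K0 : 0 < K by lra.
pose rho s := K * r s.
have rho0 s : 0 < rho s by rewrite mulr_gt0.
pose p : (S -> X) -> R := weighted_max rho.
pose d : S -> X := fun s => \sum_j c s j *: y j - b s.
(* The families with the prescribed values are the [u + y] with [u] in [N]; without a solution, none
   of them enters the open unit ball of [p]. *)
pose N (u : I -> X) := forall k j, f (nu k) (u j) = 0.
have p_ge1 u : N u -> 1 <= p (fun s => \sum_j c s j *: u j + d s).
  move=> Nu; rewrite leNgt; apply/negP => p1; apply: nex.
  exists (fun j => u j + y j); split=> [k j|s].
    by rewrite dualD Nu fy add0r.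
  under eq_bigr do rewrite scalerDr.
  rewrite big_split/= -addrA (le_trans (weighted_max_ge _ rho0 (fun s => _) s))//.
  by rewrite ler_piMl ?ltW.
(* Separation: the functional that is 0 on the perturbations coming from [N] and 1 at [d] is
   dominated by [p], hence extends to the whole product. *)
pose G0 : set ((S -> X) * R) := [set z | exists u, N u /\
  z.1 = (fun s => \sum_j c s j *: u j + z.2 *: d s)].
have [|psi [psil psip psiG]] :=
    @hahn_banach R (S -> X) p (weighted_maxD _ rho0) (weighted_maxZ _ rho0) G0.
  split.
  - exists (fun=> 0); split=> [k j|]; first by rewrite dual0.
    apply/funext => s /=; rewrite scale0r addr0 big1// => j _.
    by rewrite scaler0.
  - move=> a _ t _ t' [u [Nu /= ->]] [u' [Nu' /= ->]].
    exists (fun j => a *: u j + u' j); split=> [k j|].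
      by rewrite dualD dualZ Nu Nu' mulr0 addr0.
    apply/funext => s /=; rewrite !fctE scalerDr scaler_sumr scalerA scalerDl.
    rewrite addrACA -big_split/=; congr (_ + _); apply: eq_bigr => j _.
    by rewrite scalerDr !scalerA mulrC.
  - move=> _ t [u [Nu /= ->]].
    have [t0|t0] := leP t 0.
      by rewrite (le_trans t0)// weighted_max_ge0.
    have -> : (fun s => \sum_j c s j *: u j + t *: d s) =
        t *: (fun s => \sum_j c s j *: (t^-1 *: u j) + d s).
      apply/funext => s; rewrite -[RHS]/(t *: (_ + _)) [RHS]scalerDr scaler_sumr.
      congr (_ + _); apply: eq_bigr => j _.
      by rewrite !scalerA mulrAC mulfV ?gt_eqF// mul1r.
    rewrite /p weighted_maxZ// ler_peMr//; first exact: ltW.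
    apply: (p_ge1 (fun j => t^-1 *: u j)) => k j.
    by rewrite dualZ Nu mulr0.
have psiD u v : psi (u + v) = psi u + psi v.
  by have := psil 1 u v; rewrite scale1r mul1r.
have psi0 : psi 0 = 0.
  by have := psil (-1) 0 0; rewrite scaler0 addr0 mulN1r addNr.
(* [psi] splits into components [Psi s] in the dual of [X]; domination by the weighted maximum
   becomes a weighted ell1 bound on their norms. *)
pose single s (x : X) : S -> X := fun s' => if s' == s then x else 0.
have PsiP s : exists phi : dual X, forall x, phi x = psi (single s x).
  apply: (@bounded_dual _ _ _ (rho s)^-1).
    move=> a x x'; rewrite -psil; congr psi; apply/funext => s'.
    by rewrite /single !fctE; case: eqP => // _; rewrite scaler0 addr0.
  have psi1 x : psi (single s x) <= (rho s)^-1 * `|x|.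
    apply: (le_trans (psip _)); apply: weighted_max_le => // [|s'].
      by rewrite mulr_ge0// invr_ge0 ltW.
    rewrite /single; case: eqP => [->|_]; last first.
      by rewrite normr0 !mulr_ge0// ?invr_ge0 ltW.
    by rewrite mulrAC mulVf ?gt_eqF// mul1r.
  move=> x; rewrite ler_norml psi1 andbT lerNl.
  have -> : - psi (single s x) = psi (single s (- x)).
    have := psil (-1) (single s x) 0.
    rewrite /= mulN1r psi0 !addr0 => <-; congr psi; apply/funext => s'.
    by rewrite /single !fctE; case: eqP; rewrite ?scaleN1r// oppr0.
  by rewrite (le_trans (psi1 _))// normrN.
have [Psi PsiE] := choice PsiP.
have psi_sum v : psi v = \sum_s Psi s (v s).
  transitivity (psi (\sum_s single s (v s))).
    congr psi; apply/funext => s; rewrite fct_sumE (bigD1 s)//= big1 => [|s'].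
      by rewrite /single eqxx addr0.
    by rewrite /single eq_sym => /negPf ->.
  by rewrite (big_morph psi psiD psi0); apply: eq_bigr => s _; rewrite PsiE.
have Psi_norm : \sum_s rho s * `|Psi s| <= 1.
  apply/ler_addgt0Pr => e e0; pose rr := \sum_s rho s.
  have rr0 : 0 <= rr by apply: sumr_ge0 => s _; exact: ltW.
  have eta0 : 0 < e / (1 + rr) by rewrite divr_gt0// ltr_pwDl.
  have [x xP] := choice (fun s => dual_norm_adherent (Psi s) _ eta0).
  apply: (@le_trans _ _ (\sum_s (rho s * Psi s (x s) + rho s * (e / (1 + rr))))).
    apply: ler_sum => s _; rewrite -mulrDr ler_pM2l// -lerBlDr.
    by have [_ /ltW] := xP s.
  rewrite big_split/= -mulr_suml lerD//.
    under eq_bigr do rewrite -dualZ.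
    rewrite -(psi_sum (fun s => rho s *: x s)) (le_trans (psip _))//.
    apply: weighted_max_le => // s; rewrite mul1r normrZ gtr0_norm//.
    by rewrite ler_piMr// ?(ltW (rho0 s))//; have [] := xP s.
  rewrite -/rr mulrCA ler_piMr// ?(ltW e0)// ler_pdivrMr ?mul1r ?lerDr ?ler01//.
  by rewrite ltr_pwDl.
have psid : \sum_s Psi s (d s) = 1.
  rewrite -psi_sum; apply: psiG; exists (fun=> 0); split=> [k j|].
    by rewrite dual0.
  apply/funext => s /=; rewrite scale1r big1 ?add0r// => j _.
  by rewrite scaler0.
(* Since [psi] kills the perturbations, [g j] vanishes on the common kernel of the [f (nu k)] and is
   a combination of them. So [J (g j)] lives on the indices [nu k], where [xi j] and [y j] have the
   same coordinates. *)
pose g j := \sum_s c s j *: Psi s.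
have gN j x : (forall k, f (nu k) x = 0) -> g j x = 0.
  move=> Nx; rewrite /g dual_sumE.
  transitivity (psi (fun s => c s j *: x)).
    by rewrite psi_sum; apply: eq_bigr => s _; rewrite dualZ.
  apply: psiG; exists (fun i => if i == j then x else 0); split=> [k i|].
    by case: eqP => _; rewrite ?dual0.
  apply/funext => s /=; rewrite scale0r addr0 (bigD1 j)//= eqxx.
  by rewrite big1 ?addr0// => i /negPf ->; rewrite scaler0.
have gE j : g j = \sum_k g j (y k) *: f (nu k).
  apply/val_inj/funext => x; apply/eqP; rewrite -subr_eq0.
  have <- : g j (x - \sum_k f (nu k) x *: y k) =
      g j x - (\sum_k g j (y k) *: f (nu k)) x.
    rewrite dualB dual_sum; congr (_ - _); rewrite dual_sumE; apply: eq_bigr => k _.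
    by rewrite dualZ dual_scaleE mulrC.
  apply/eqP/gN => k; rewrite dualB dual_sum (bigD1 k)//= dualZ fy eqxx mulr1.
  rewrite big1 ?addr0 ?subrr// => i ik.
  by rewrite dualZ fy eq_sym (negPf ik) mulr0.
have JgE j n : J (g j) n * xi j n = J (g j) n * f n (y j).
  have [[k <-]|nuk] := pselect (exists k, nu k = n); first by rewrite fxi fy.
  suff -> : J (g j) n = 0 by rewrite !mul0r.
  rewrite gE raddf_sum ell1_sumE big1// => k _.
  rewrite /= linearZ Jf.
  rewrite -[LHS]/(g j (y k) * (n == nu k)%:R).
  by case: eqP => [e|]; [case: nuk; exists k|rewrite mulr0].
have term n : \sum_s J (Psi s) n * f n (d s) =
    \sum_s J (Psi s) n * (\sum_j c s j * xi j n - f n (b s)).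
  have swap (z : I -> R) : \sum_s J (Psi s) n * (\sum_j c s j * z j) =
      \sum_j J (g j) n * z j.
    under eq_bigr do rewrite mulr_sumr.
    rewrite exchange_big/=; apply: eq_bigr => j _.
    rewrite /g raddf_sum ell1_sumE mulr_suml; apply: eq_bigr => s _.
    by rewrite /= linearZ ell1_scaleE; ring.
  under eq_bigr do rewrite /d dualB dual_sum mulrBr.
  under [RHS]eq_bigr do rewrite mulrBr.
  rewrite !big_split/=; congr (_ + _).
  rewrite [RHS]swap; under [RHS]eq_bigr do rewrite JgE.
  rewrite -swap; apply: eq_bigr => s _; congr (_ * _).
  by apply: eq_bigr => j _; rewrite dualZ.
(* Expanding along the [f n] and exchanging [y] for [xi] term by term makes the hypothesis on [xi]
   applicable. The left side is 1 while the right side is at most [1 / K], which contradicts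
   [1 < K]. *)
have : \sum_s Psi s (d s) <= \sum_s r s * `|Psi s|.
  have cv : (fun M => \sum_s series (fun n => J (Psi s) n * f n (d s)) M) @ \oo
      --> \sum_s Psi s (d s).
    by apply: cvg_big => [|s _]; [exact: add_continuous|exact: dual_expansion].
  rewrite -(cvg_lim (@Rhausdorff R) cv).
  apply: limr_le; first by apply/cvg_ex; eexists; exact: cv.
  apply: nearW => M; rewrite /series /= exchange_big/=.
  under eq_bigr do rewrite term.
  rewrite exchange_big/=; apply: ler_sum => s _.
  apply: (@le_trans _ _ (\sum_(0 <= n < M) r s * `|J (Psi s) n|)).
    apply: ler_sum => n _; rewrite (le_trans (ler_norm _))// normrM mulrC.
    by rewrite ler_wpM2r// xiP.
  rewrite -mulr_sumr ler_pM2l//.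
  by rewrite -J_isometric; exact: ell1_norm_ge.
rewrite psid => h1.
have : K * \sum_s r s * `|Psi s| <= 1.
  by rewrite mulr_sumr; under eq_bigr do rewrite mulrA.
have := ler_pM2l K0 1 (\sum_s r s * `|Psi s|); rewrite h1 => /idP; lra.
Qed.

End local_reflexivity.

(** * Finite-dimensional stages *)

Section cube.
Context {R : realType} {X : normedModType R}.

Lemma norm_segment_le (u x : X) (c M : R) : `|c| <= 1 ->
  `|u + x| <= M -> `|u - x| <= M -> `|u + c *: x| <= M.
Proof.
rewrite ler_norml => /andP[c1 c1'] hp hm.
have -> : u + c *: x = ((1 + c) / 2) *: (u + x) + ((1 - c) / 2) *: (u - x).
  rewrite !scalerDr scalerN addrACA -scalerDl -scalerBl.
  have -> : (1 + c) / 2 + (1 - c) / 2 = 1 by lra.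
  have -> : (1 + c) / 2 - (1 - c) / 2 = c by lra.
  by rewrite scale1r.
rewrite (le_trans (ler_normD _ _))// !normrZ !ger0_norm; [|lra..].
have := @ler_wpM2l _ ((1 + c) / 2) ltac:(lra) _ _ hp.
have := @ler_wpM2l _ ((1 - c) / 2) ltac:(lra) _ _ hm.
lra.
Qed.

(** By convexity the norm on a cube is bounded by its values at the vertices; the induction absorbs
    the last coordinate into [u]. This leaves finitely many sign patterns, as local reflexivity
    demands. *)
Lemma norm_cube_le m (x : nat -> X) (M : R) (u : X) :
  (forall e : nat -> bool, `|u + \sum_(j < m) (-1) ^+ e j *: x j| <= M) ->
  forall c : nat -> R, (forall j, (j < m)%N -> `|c j| <= 1) ->
  `|u + \sum_(j < m) c j *: x j| <= M.
Proof.
elim: m u => [|m IHm] u hM c c1.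
  by rewrite big_ord0; have := hM (fun=> false); rewrite big_ord0.
have face b : `|(u + (-1) ^+ (b : bool) *: x m) + \sum_(j < m) c j *: x j| <= M.
  apply: IHm => [e|j jm]; last by rewrite c1// ltnW.
  have := hM (fun j => if j == m then b else e j); rewrite big_ord_recr/= eqxx.
  rewrite addrA addrAC; under eq_bigr do rewrite ltn_eqF//.
  by [].
rewrite big_ord_recr/= addrA; apply: norm_segment_le; first exact: c1.
- by have := face false; rewrite scale1r addrAC.
- by have := face true; rewrite scaleN1r addrAC.
Qed.

End cube.

Section almost_lift.
Context {R : realType} {X : normedModType R}.
Context (J : {linear dual X -> ell1 R}) (J_isometric : isometric J).
Context (f : nat -> dual X) (Jf : forall n, J (f n) = ell1_basis n).
Context (nu : nat -> nat) (nu_inj : injective nu).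

(** A right inverse of the first [m] coordinates [f (nu k)] on the sup-normed m-dimensional space,
    of norm at most [1 + e]. Only the first [m] values of [x] matter. *)
Definition almost_lift m (e : R) (x : nat -> X) :=
  (forall k j, (k < m)%N -> (j < m)%N -> f (nu k) (x j) = (k == j)%:R) /\
  forall c : nat -> R, (forall j, (j < m)%N -> `|c j| <= 1) ->
    `|\sum_(j < m) c j *: x j| <= 1 + e.

(** [f (nu m)] is no combination of the earlier functionals, as its image under [J] has coordinate 1
    at [nu m] and theirs have 0. A vector detecting this, once corrected and normalised, gives [w],
    which then adjusts the old vectors. No norm control is claimed. *)
Lemma biorthogonal_extend m e x : almost_lift m e x ->
  exists y : nat -> X,
    forall k j, (k < m.+1)%N -> (j < m.+1)%N -> f (nu k) (y j) = (k == j)%:R.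
Proof.
move=> [fx _].
pose comb := \sum_(k < m) f (nu m) (x k) *: f (nu k).
have [v vP] : exists v, f (nu m) v - comb v != 0.
  apply: contrapT => /forallNP h.
  have fE : f (nu m) = comb.
    by apply/val_inj/funext => v; have /negP/negPn := h v; rewrite subr_eq0 => /eqP.
  have := congr1 (fun phi => J phi (nu m)) fE.
  rewrite /comb Jf raddf_sum ell1_sumE big1 => [|k _].
    by rewrite /= eqxx => /eqP; rewrite oner_eq0.
  rewrite /= linearZ Jf -[LHS]/(_ * (nu m == nu k)%:R).
  by rewrite (inj_eq nu_inj) gtn_eqF// mulr0.
pose t := f (nu m) v - comb v.
pose w := t^-1 *: (v - \sum_(k < m) f (nu k) v *: x k).
have fw k : (k < m.+1)%N -> f (nu k) w = (k == m)%:R.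
  rewrite ltnS leq_eqVlt /w dualZ dualB dual_sum => /orP[/eqP ->|km].
    rewrite eqxx; apply: (canLR (mulKf vP)); rewrite mulr1; congr (_ - _).
    by rewrite /comb dual_sumE; apply: eq_bigr => k' _; rewrite dualZ mulrC.
  rewrite ltn_eqF// (bigD1 (Ordinal km))//= dualZ fx// eqxx mulr1.
  rewrite big1 ?addr0 ?subrr ?mulr0// => i ik.
  rewrite dualZ fx// (_ : (k == i) = false) ?mulr0//.
  by apply: contra_neqF ik => /eqP ki; apply/val_inj.
exists (fun j => if (j < m)%N then x j - f (nu m) (x j) *: w else w) => k j km jm.
case: ifPn => jm'; last by rewrite fw//; congr ((_ == _)%:R); lia.
rewrite dualB dualZ fw//; have [->|kNm] := eqVneq k m.
  by rewrite mulr1 subrr gtn_eqF.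
by rewrite mulr0 subr0 fx//; lia.
Qed.

Lemma almost_lift_extend m e e' x : 0 < e -> 0 < e' -> almost_lift m e x ->
  exists x', almost_lift m.+1 e' x' /\
    forall i, (i < m)%N ->
      `|\sum_(k < m.+1) f (nu k) (x i) *: x' k - x i| <= (1 + e') * e.
Proof.
move=> e0 e'0 ax; have [y fy] := biorthogonal_extend _ _ _ ax.
have [fx xe] := ax; have e1 : 0 < 1 + e by lra.
(* A left index asks a signed sum of the new vectors to have norm at most 1; a right index asks the
   old vector [x i] to be reproduced within [e]. Both bounds are met up to the factor [1 + e']. *)
pose S := ({ffun 'I_m.+1 -> bool} + 'I_m)%type.
pose c (s : S) (j : 'I_m.+1) : R :=
  match s with inl g => (-1) ^+ g j | inr i => f (nu j) (x i) end.
pose b (s : S) : X := match s with inl _ => 0 | inr i => x i end.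
pose r (s : S) : R := match s with inl _ => 1 | inr _ => e end.
(* With these bidual vectors the next stage has norm at most 1; dividing by [1 + e]
   off the indices [nu k] is what moves the old stage, by at most [e]. *)
pose xi (j : 'I_m.+1) (n : nat) : R :=
  if [pick k : 'I_m.+1 | nu k == n] is Some k then (k == j)%:R
  else if (j < m)%N then f n (x j) / (1 + e) else 0.
have xie i : (i < m)%N -> `|x i| <= 1 + e.
  move=> im; have := xe (fun j => (j == i)%:R).
  rewrite (bigD1 (Ordinal im))//= eqxx scale1r big1 ?addr0 => [|j ji].
    by apply => j _; case: eqP; rewrite ?normr1 ?normr0.
  rewrite (_ : (_ == _) = false) ?scale0r//.
  by apply: contra_neqF ji => /eqP ji; exact/val_inj.
have [| | | | |x' [fx' x'P]] := @local_reflexivity _ _ J J_isometric f Jf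
    'I_m.+1 S (nu \o val) (y \o val) c b r xi (1 + e').
- by move=> k j /=; rewrite fy.
- move=> k j; rewrite /xi /=; case: pickP => [k' /eqP/nu_inj/val_inj -> //|].
  by move=> /(_ k); rewrite eqxx.
- by case.
- lra.
- move=> s n; rewrite /xi; case: pickP => [k /eqP <-|nk].
    have -> : \sum_j c s j * (k == j)%:R = c s k.
      rewrite (bigD1 k)//= eqxx mulr1 big1 ?addr0// => j /negPf jk.
      by rewrite eq_sym jk mulr0.
    case: s => [g|i] /=; first by rewrite dual0 subr0 normrX normrN1 expr1n.
    by rewrite subrr normr0 ltW.
  (* Off the indices [nu k] one evaluates [f n] at an old vector of norm at most [1 + e], divided by
     [1 + e]. *)
  have -> : \sum_j c s j * (if (j < m)%N then f n (x j) / (1 + e) else 0) =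
      f n (\sum_(j < m) c s (widen_ord (leqnSn m) j) *: x j) / (1 + e).
    rewrite big_ord_recr/= ltnn mulr0 addr0 dual_sum mulr_suml.
    by apply: eq_bigr => j _; rewrite ltn_ord dualZ mulrA.
  case: s => [g|i] /=.
    rewrite dual0 subr0 normrM normfV (gtr0_norm e1) ler_pdivrMr// mul1r.
    rewrite (le_trans (predual_basis_le _ J_isometric _ Jf _ _))//.
    have -> : \sum_(j < m) (-1) ^+ g (widen_ord (leqnSn m) j) *: x j =
        \sum_(j < m) ((-1) ^+ g (inord j) : R) *: x j.
      apply: eq_bigr => j _.
      rewrite (_ : inord j = widen_ord (leqnSn m) j)//; apply/val_inj.
      by rewrite /= inordK// ltnW// ltnS.
    by apply: (xe (fun j => (-1) ^+ g (inord j))) => j _; rewrite normrX normrN1 expr1n.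
  have -> : \sum_(j < m) f (nu j) (x i) *: x j = x i.
    rewrite (bigD1 i)//= fx// eqxx scale1r big1 ?addr0// => j ji.
    rewrite fx// (_ : (_ == _) = false) ?scale0r//.
    by apply: contra_neqF ji => /eqP ji; exact/val_inj.
  have -> : f n (x i) / (1 + e) - f n (x i) = f n (x i) / (1 + e) * - e.
    by field; lra.
  rewrite normrM normrN (gtr0_norm e0) ler_piMl ?(ltW e0)//.
  rewrite normrM normfV (gtr0_norm e1) ler_pdivrMr// mul1r.
  by rewrite (le_trans (predual_basis_le _ J_isometric _ Jf _ _))// xie.
have xinord (j : 'I_m.+1) : x' (inord j) = x' j by rewrite inord_val.
exists (fun j => x' (inord j)); split; last first.
  move=> i im; rewrite (eq_bigr (fun k : 'I_m.+1 => f (nu k) (x i) *: x' k)).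
    exact: x'P (inr (Ordinal im)).
  by move=> k _; rewrite xinord.
split=> [k j km jm|a a1].
  have := fx' (inord k) (inord j); rewrite /= inordK// => ->.
  by rewrite -val_eqE /= !inordK.
rewrite -[X in `|X|]add0r; apply: (norm_cube_le _ (fun j => x' (inord j))) => // g.
rewrite add0r (eq_bigr (fun j : 'I_m.+1 => c (inl [ffun j => g (val j)]) j *: x' j)).
  by have := x'P (inl [ffun j => g (val j)]); rewrite /= subr0 mulr1.
by move=> j _; rewrite /= ffunE xinord.
Qed.

Lemma almost_lift_sequence (eps : nat -> R) : (forall m, 0 < eps m) ->
  exists x : nat -> nat -> X, (forall m, almost_lift m (eps m) (x m)) /\
    forall m i, (i < m)%N ->
      `|\sum_(k < m.+1) f (nu k) (x m i) *: x m.+1 k - x m i| <=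
      (1 + eps m.+1) * eps m.
Proof.
move=> eps0.
(* Stating the extension as an implication gives a total choice function on pairs, which can be
   iterated from the empty stage; 0 is the default where the premise fails. *)
have next (z : nat * (nat -> X)) : exists x', almost_lift z.1 (eps z.1) z.2 ->
    almost_lift z.1.+1 (eps z.1.+1) x' /\ forall i, (i < z.1)%N ->
      `|\sum_(k < z.1.+1) f (nu k) (z.2 i) *: x' k - z.2 i| <=
      (1 + eps z.1.+1) * eps z.1.
  have [az|na] := pselect (almost_lift z.1 (eps z.1) z.2); last by exists 0.
  have [x' x'P] := almost_lift_extend _ _ _ _ (eps0 _) (eps0 z.1.+1) az.
  by exists x'.
have [F FP] := choice next.
pose x := nat_rect (fun=> nat -> X) (fun=> 0) (fun m xm => F (m, xm)).
have ax m : almost_lift m (eps m) (x m).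
  elim: m => [|m IHm]; last by have [] := FP (m, x m) IHm.
  split=> // c _; rewrite big_ord0 normr0 addr_ge0// ltW//.
by exists x; split=> // m; have [] := FP (m, x m) (ax m).
Qed.

End almost_lift.

(** * The lifting of W_alpha *)

Section lifting.
Context {R : realType} {X : completeNormedModType R}.
Context (h : nat -> dual X) (h_le : forall k x, `|h k x| <= `|x|).
(** The factor [m.+1] absorbs a sum over the [m] vectors of a stage, the power of 2 makes the errors
    summable, and 16 leaves room for the constants in the telescoping. *)
Let eps m : R := (16 * m.+1%:R * 2 ^+ m)^-1.
Context (x : nat -> nat -> X).
Context (x_biorth : forall m k j, (k < m)%N -> (j < m)%N ->
  h k (x m j) = (k == j)%:R).
Context (x_norm : forall m (c : nat -> R), (forall j, (j < m)%N -> `|c j| <= 1) ->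
  `|\sum_(j < m) c j *: x m j| <= 1 + eps m).
Context (x_step : forall m i, (i < m)%N ->
  `|\sum_(k < m.+1) h k (x m i) *: x m.+1 k - x m i| <= (1 + eps m.+1) * eps m).

Definition partial_lift m (w : nat -> R) : X := \sum_(j < m) w j *: x m j.
Local Notation U := partial_lift.

Let eps0 m : 0 < eps m.
Proof. by rewrite invr_gt0 !mulr_gt0// exprn_gt0. Qed.

Let epsE m : eps m * m.+1%:R = (2 ^+ m)^-1 / 16.
Proof.
rewrite /eps; field; rewrite ?pnatr_eq0//= expf_neq0//.
by rewrite addrC natr1 pnatr_eq0.
Qed.

Let eps_le m : eps m <= (2 ^+ m)^-1.
Proof.
have p0 : 0 < ((2 : R) ^+ m)^-1 by rewrite invr_gt0 exprn_gt0.
have := epsE m; rewrite -natr1 mulrDr mulr1.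
have : 0 <= eps m * m%:R by rewrite mulr_ge0// ltW.
lra.
Qed.

Let eps_le1 m : eps m <= 1.
Proof. by rewrite (le_trans (eps_le m))// invf_le1 ?exprn_ege1 ?exprn_gt0// ler1n. Qed.

Lemma partial_lift_linear m a v w : U m (a *: v + w) = a *: U m v + U m w.
Proof.
rewrite /U scaler_sumr -big_split/=; apply: eq_bigr => j _.
by rewrite scalerDl scalerA.
Qed.

Lemma partial_liftB m v w : U m (v - w) = U m v - U m w.
Proof. by rewrite addrC -[- w]scaleN1r partial_lift_linear scaleN1r addrC. Qed.

Lemma eq_partial_lift m v w : (forall j, (j < m)%N -> v j = w j) -> U m v = U m w.
Proof. by move=> vw; apply: eq_bigr => j _; rewrite vw. Qed.

Lemma partial_liftK m w k : (k < m)%N -> h k (U m w) = w k.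
Proof.
move=> km; rewrite dual_sum (bigD1 (Ordinal km))//= dualZ x_biorth// eqxx mulr1.
rewrite big1 ?addr0// => i ik; rewrite dualZ x_biorth//.
rewrite (_ : (k == i) = false) ?mulr0//.
by apply: contra_neqF ik => /eqP ki; apply/val_inj.
Qed.

Lemma partial_lift_le m w B : 0 < B -> (forall j, (j < m)%N -> `|w j| <= B) ->
  `|U m w| <= (1 + eps m) * B.
Proof.
move=> B0 wB; rewrite -ler_pdivrMr// -[X in X <= _]mulrC.
rewrite -[B in B^-1](gtr0_norm B0) -normfV -normrZ scaler_sumr.
under eq_bigr do rewrite scalerA.
apply: (x_norm m (fun j => B^-1 * w j)) => j jm.
by rewrite normrM normfV (gtr0_norm B0) ler_pdivrMl// mulr1 wB.
Qed.

Lemma partial_lift_le2 m w B : 0 < B -> (forall j, (j < m)%N -> `|w j| <= B) ->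
  `|U m w| <= 2 * B.
Proof.
move=> B0 wB; rewrite (le_trans (partial_lift_le _ _ _ B0 wB))//.
by rewrite ler_pM2r//; have := eps_le1 m; lra.
Qed.

(** By linearity the difference is a combination, with coefficients [w i], of the [m] errors in
    [x_step], each at most [2 * eps m]. *)
Lemma partial_lift_step m w B : 0 <= B -> (forall j, (j < m)%N -> `|w j| <= B) ->
  `|U m.+1 (fun k => h k (U m w)) - U m w| <= (2 ^+ m)^-1 / 8 * B.
Proof.
move=> B0 wB.
have -> : U m.+1 (fun k => h k (U m w)) - U m w =
    \sum_(i < m) w i *: (\sum_(k < m.+1) h k (x m i) *: x m.+1 k - x m i).
  under [RHS]eq_bigr do rewrite scalerBr.
  rewrite big_split/= sumrN; congr (_ - _).
  under [RHS]eq_bigr do rewrite scaler_sumr.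
  rewrite exchange_big/=; apply: eq_bigr => k _.
  rewrite dual_sum scaler_suml; apply: eq_bigr => i _.
  by rewrite dualZ scalerA.
rewrite (le_trans (ler_norm_sum _ _ _))//.
apply: (@le_trans _ _ (\sum_(i < m) B * (2 * eps m))).
  apply: ler_sum => i _; rewrite normrZ ler_pM// ?wB//.
  rewrite (le_trans (x_step _ _ _))// ler_pM2r//.
  by have := eps_le1 m.+1; lra.
rewrite sumr_const card_ord -[leLHS]mulr_natr -mulrA mulrC ler_wpM2r//.
have := epsE m; rewrite -natr1 mulrDr mulr1.
have := eps0 m; lra.
Qed.

(** Each new [v] consists of the coordinates of the previous approximation. These stay within
    [3 * B], so a step costs at most half of [(2 ^+ (m + i))^-1 * B], and the costs telescope. *)
Lemma partial_lift_chain m w B : 0 < B -> (forall j, (j < m)%N -> `|w j| <= B) ->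
  forall i, exists v, `|U (m + i) v - U m w| <=
    ((2 ^+ m)^-1 - (2 ^+ (m + i))^-1) * B.
Proof.
move=> B0 wB; elim=> [|i [v vP]].
  by exists w; rewrite addn0 !subrr normr0 mul0r.
have p0 n : 0 < ((2 : R) ^+ n)^-1 by rewrite invr_gt0 exprn_gt0.
have p1 n : ((2 : R) ^+ n)^-1 <= 1.
  by rewrite invf_le1 ?exprn_ege1 ?exprn_gt0// ler1n.
exists (fun k => h k (U (m + i) v)); rewrite addnS.
have Uv : `|U (m + i) v| <= 3 * B.
  rewrite -[X in `|X|](subrK (U m w)) (le_trans (ler_normD _ _))//.
  have := partial_lift_le2 _ _ _ B0 wB.
  have : ((2 ^+ m)^-1 - (2 ^+ (m + i))^-1) * B <= 1 * B.
    by rewrite ler_pM2r//; have := p1 m; have := p0 (m + i)%N; lra.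
  by move: vP; lra.
have := partial_lift_step (m + i) v (3 * B) ltac:(lra).
have vB j : (j < m + i)%N -> `|v j| <= 3 * B.
  by move=> ji; rewrite -(partial_liftK (m + i) v j ji) (le_trans (h_le _ _)).
move=> /(_ vB) st; rewrite -[X in `|X|](subrKA (U (m + i) v)).
rewrite (le_trans (ler_normD _ _))//.
have q : (2 ^+ (m + i).+1)^-1 = (2 ^+ (m + i))^-1 / 2 :> R.
  by rewrite exprS invfM mulrC.
rewrite q; have := mulr_gt0 (p0 (m + i)%N) B0.
move: vP st; rewrite !mulrBl; lra.
Qed.

(** The chain gives [U i v] close to [U m w]. As the [h k] are contractions, [v] is equally close to
    the coordinates of [U m w], and [U i] at most doubles this: 1 + 2 = 3. *)
Lemma partial_lift_proj m w B : 0 < B -> (forall j, (j < m)%N -> `|w j| <= B) ->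
  forall i, (m <= i)%N ->
  `|U i (fun k => h k (U m w)) - U m w| <= 3 * (2 ^+ m)^-1 * B.
Proof.
move=> B0 wB i mi; have p0 n : 0 < ((2 : R) ^+ n)^-1 by rewrite invr_gt0 exprn_gt0.
have [v] := partial_lift_chain _ _ _ B0 wB (i - m).
rewrite subnKC// => vP.
have {}vP : `|U i v - U m w| <= (2 ^+ m)^-1 * B.
  by rewrite (le_trans vP)// ler_pM2r//; have := p0 i; lra.
have : `|U i (fun k => h k (U m w)) - U i v| <= 2 * ((2 ^+ m)^-1 * B).
  rewrite -partial_liftB; apply: partial_lift_le2 => [|j ji].
    by rewrite mulr_gt0.
  rewrite -[(_ - _) j]/(h j (U m w) - v j) -(partial_liftK i v j ji) -dualB.
  by rewrite (le_trans (h_le _ _))// distrC.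
move=> h1; rewrite -[X in `|X|](subrKA (U i v)) (le_trans (ler_normD _ _))//.
move: vP h1; lra.
Qed.

Context (alpha : ell1 R) (h_cvg : forall z,
  (fun k => h k z) @ \oo --> limn (series (fun k => alpha k * h k z))).

(** * Convergence of the partial lifts by averaging *)

Section fixed_element.
Context (w : W alpha) (B : R) (B0 : 0 < B) (wB : `|w| <= B).

Lemma W_coord_le (v : W alpha) k : `|v k| <= `|v|.
Proof. exact: cseq_norm_ge. Qed.

Let wkB k : `|w k| <= B.
Proof. exact: le_trans (W_coord_le _ _) wB. Qed.

Lemma partial_lift_error m k : `|h k (U m w) - w k| <= 3 * B.
Proof.
rewrite (le_trans (ler_normB _ _))//.
have := partial_lift_le2 m w B B0 (fun j _ => wkB j).
by have := h_le k (U m w); have := wkB k; lra.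
Qed.

(** The coordinates of [U m w], by [h_cvg], and [w], as an element of [W alpha], both have their
    limit given by the [alpha] series; hence so does the difference. *)
Lemma partial_lift_error_cvg m :
  (fun k => h k (U m w) - w k) @ \oo -->
  limn (series (fun k => alpha k * (h k (U m w) - w k))).
Proof.
have cvw := @W_summable _ alpha w.
have hc : cvgn (fun k => h k (U m w)) by apply/cvg_ex; eexists; exact: h_cvg.
pose hw : cseq R := @CSeq R (fun k => h k (U m w)) (mem_set hc).
have cvh : cvgn (series (fun k => alpha k * h k (U m w))).
  exact: (@W_summable _ alpha hw).
have -> : series (fun k => alpha k * (h k (U m w) - w k)) =
    series (fun k => alpha k * h k (U m w)) - series (fun k => alpha k * w k).
  apply/funext => n; rewrite /series /= !fctE -sumrB.
  by apply: eq_bigr => k _; rewrite mulrBr.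
rewrite limB//; apply: cvgB; first exact: h_cvg.
have := W_P w; rewrite inE /= => <-.
exact: cseq_cvg.
Qed.

(** The error vanishes below [m] and never exceeds [3 * B], so only the tail of [alpha] beyond [m]
    contributes. *)
Lemma partial_lift_error_tail m : forall e, 0 < e ->
  `|alpha| - \sum_(0 <= k < m) `|alpha k| <= e / (3 * B) ->
  `|limn (series (fun k => alpha k * (h k (U m w) - w k)))| <= e.
Proof.
move=> e e0 tail.
set D := fun k => alpha k * (h k (U m w) - w k).
have cD : cvgn (series D).
  apply: normed_cvg; apply: (@series_le_cvg _ _ (fun k => (3 * B) * `|alpha k|)).
  - by move=> k; exact: normr_ge0.
  - by move=> k; rewrite !mulr_ge0// ltW.
  - move=> k; rewrite /= normrM mulrC ler_wpM2r//; exact: partial_lift_error.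
  - exact: (@is_cvg_seriesZ R (fun n => `|alpha n|) _ (@ell1_summable _ alpha)).
have cnD : `|series D n| @[n --> \oo] --> `|limn (series D)|.
  exact: cvg_norm.
rewrite -(cvg_lim (@Rhausdorff R) cnD).
apply: limr_le; first by apply/cvg_ex; eexists; exact: cnD.
exists m => // N /= mN.
have D0 k : (k < m)%N -> D k = 0.
  by move=> km; rewrite /D partial_liftK// subrr mulr0.
rewrite /series /= (big_cat_nat (leq0n m) mN)/=.
rewrite [X in X + _]big_nat big1 ?add0r; last first.
  by move=> k /andP[_ km]; rewrite D0.
rewrite (le_trans (ler_norm_sum _ _ _))//.
apply: (@le_trans _ _ ((3 * B) * \sum_(m <= k < N) `|alpha k|)).
  rewrite mulr_sumr; apply: ler_sum => k _; rewrite normrM mulrC ler_wpM2r//.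
  exact: partial_lift_error.
rewrite mulrC -ler_pdivlMr ?mulr_gt0// (le_trans _ tail)// lerBrDl.
rewrite -(big_cat_nat (leq0n m) mN); exact: ell1_norm_ge.
Qed.

(* Gliding hump: the error of [U m w] vanishes at the coordinates below [m] and is
   small far out, so that the humps of well spaced stages hardly overlap. *)
Lemma gliding_hump e L : 0 < e -> exists z M,
  [/\ forall k, `|h k z - L%:R * w k| <= L%:R * e + 3 * B,
      forall k, (M <= k)%N -> `|h k z - L%:R * w k| <= L%:R * e &
      forall i, (M <= i)%N -> `|U i (fun k => h k z) - z| <= L%:R * e].
Proof.
move=> e0.
have [i0 i0P] : exists i0, forall i, (i0 <= i)%N ->
    3 * (2 ^+ i)^-1 * B <= e /\
    `|alpha| - \sum_(0 <= k < i) `|alpha k| <= (e / 2) / (3 * B).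
  have e3 : 0 < (e / 2) / (3 * B) by rewrite !divr_gt0// mulr_gt0.
  have /cvgrPdist_le/(_ _ e3) [i1 _ i1P] := @ell1_norm_cvg _ alpha.
  have e4 : 0 < e / (3 * B) by rewrite divr_gt0// mulr_gt0.
  have half1 : `|(2 : R)^-1| < 1 by rewrite gtr0_norm; lra.
  have /cvgrPdist_le/(_ _ e4) [i2 _ i2P] := cvg_expr half1.
  exists (maxn i1 i2) => i; rewrite geq_max => /andP[ii1 ii2]; split; last first.
    exact: le_trans (ler_norm _) (i1P _ ii1).
  have := i2P _ ii2; rewrite /= sub0r normrN exprVn ger0_norm ?invr_ge0 ?exprn_ge0//.
  by rewrite ler_pdivlMr ?mulr_gt0// => ?; lra.
elim: L => [|L [z [M [z1 z2 z3]]]].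
  exists 0, 0%N; split=> [k|k _|i _].
  - by rewrite dual0 !mul0r subrr normr0 add0r mulr_ge0// ltW.
  - by rewrite dual0 !mul0r subrr normr0.
  - rewrite mul0r subr0 /U big1 ?normr0// => j _.
    by rewrite dual0 scale0r.
(* Below [m] the new error is 0; from [m] on the previous errors sum to at most [L * e]. So the
   bound [3 * B] is paid at most once at each coordinate. *)
pose m := maxn M i0.
have [m1 m2] := i0P m (leq_maxr _ _).
have := partial_lift_error_cvg m => /cvgrPdist_le /(_ (e / 2)).
have tail := partial_lift_error_tail m (e / 2) ltac:(lra) m2.
move=> /(_ ltac:(lra)) [M' _ M'P].
have far k : (M' <= k)%N -> `|h k (U m w) - w k| <= e.
  move=> /M'P /= d; move: tail d; set l := limn _ => l1 l2.
  rewrite -[X in `|X|](subKr l) (le_trans (ler_normB _ _))//; lra.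
exists (z + U m w), (maxn m M').
have split_err k : h k (z + U m w) - L.+1%:R * w k =
    (h k z - L%:R * w k) + (h k (U m w) - w k).
  by rewrite dualD -natr1; ring.
split.
- move=> k; rewrite split_err; have [km|mk] := ltnP k m.
    rewrite partial_liftK// subrr addr0 (le_trans (z1 k))// lerD2r.
    by rewrite ler_wpM2r ?ler_nat// ltW.
  have := partial_lift_error m k; have := z2 k (leq_trans (leq_maxl _ _) mk).
  rewrite -natr1 mulrDl mul1r => a b; rewrite (le_trans (ler_normD _ _))//; lra.
- move=> k; rewrite geq_max => /andP[mk M'k]; rewrite split_err.
  have := far k M'k; have := z2 k (leq_trans (leq_maxl _ _) mk).
  rewrite -natr1 mulrDl mul1r => a b; rewrite (le_trans (ler_normD _ _))//; lra.
- move=> i; rewrite geq_max => /andP[mi _].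
  have -> : U i (fun k => h k (z + U m w)) - (z + U m w) =
      (U i (fun k => h k z) - z) + (U i (fun k => h k (U m w)) - U m w).
    rewrite addrACA -opprD; congr (_ - _).
    have := partial_lift_linear i 1 (fun k => h k z) (fun k => h k (U m w)).
    rewrite !scale1r => <-.
    by apply: eq_partial_lift => j _; rewrite dualD.
  have := partial_lift_proj m w B B0 (fun j _ => wkB j) i mi.
  have := z3 i (leq_trans (leq_maxl _ _) mi).
  rewrite -natr1 mulrDl mul1r => a b; rewrite (le_trans (ler_normD _ _))//; lra.
Qed.

(** Dividing the hump vector by [L] leaves a coordinate error of at most [e + 3 * B / L <= 2 * e].
    [U i] at most doubles it to [4 * e], and replacing [U i] of the coordinates by the vector itself
    costs one more [e]. *)
Lemma partial_lift_almost_cvg e : 0 < e -> exists z M,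
  forall i, (M <= i)%N -> `|U i w - z| <= 5 * e.
Proof.
move=> e0; pose L := (Num.trunc (3 * B / e)).+1.
have L0 : 0 < L%:R :> R by rewrite ltr0n.
have LB : 3 * B <= L%:R * e.
  rewrite -ler_pdivrMr// ltW//; apply: truncnS_gt.
have [z [M [z1 _ z3]]] := gliding_hump e L e0.
exists (L%:R^-1 *: z), M => i Mi.
have zi := z3 i Mi.
have : `|U i (L%:R *: (w : nat -> R) - (fun k => h k z))| <= 2 * (L%:R * (2 * e)).
  apply: partial_lift_le2 => [|j _]; first by rewrite !mulr_gt0.
  rewrite -[(_ - _) j]/(L%:R * w j - h j z) distrC (le_trans (z1 j))//.
  by lra.
rewrite partial_liftB -[_ *: (_ : nat -> R)]addr0 partial_lift_linear.
have -> : U i 0 = 0 by rewrite /U big1// => j _; rewrite scale0r.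
rewrite addr0 => h1.
have -> : U i w - L%:R^-1 *: z = L%:R^-1 *: (L%:R *: U i w - z).
  by rewrite scalerBr scalerA mulVf ?gt_eqF// scale1r.
rewrite normrZ normfV gtr0_norm// ler_pdivrMl//.
rewrite -[X in `|X|](subrKA (U i (fun k => h k z))).
rewrite (le_trans (ler_normD _ _))//; lra.
Qed.

End fixed_element.

Lemma partial_lift_is_cvg (w : W alpha) : cvg ((fun i => U i w) @ \oo).
Proof.
apply/cauchy_cvgP/cauchy_exP => e e0.
(* Adding 1 keeps the bound positive when [w = 0]; [e / 6] makes the resulting [5 * (e / 6)]
   strictly smaller than [e]. *)
have w0 : 0 < `|w| + 1 by rewrite ltr_wpDl.
have [z [M zM]] :=
  partial_lift_almost_cvg w (`|w| + 1) w0 ltac:(lra) (e / 6) ltac:(lra).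
exists z; exists M => // i Mi /=; rewrite -ball_normE /= distrC.
by rewrite (le_lt_trans (zM i Mi))//; lra.
Qed.

(** * The limit embedding and the projection onto its range *)

Definition lift (w : W alpha) : X := lim ((fun i => U i w) @ \oo).

Lemma lift_cvg w : (fun i => U i (w : W alpha)) @ \oo --> lift w.
Proof. exact: partial_lift_is_cvg. Qed.

Lemma lift_linear : linear lift.
Proof.
move=> a v w; apply: cvg_lim => //=.
rewrite (_ : (fun i => _) = fun i => a *: U i v + U i w).
  by apply: cvgD; [apply: cvgZl_tmp; exact: lift_cvg|exact: lift_cvg].
by apply/funext => i; rewrite -partial_lift_linear.
Qed.

Lemma liftK (w : W alpha) k : h k (lift w) = w k.
Proof.
have c1 : (fun i => h k (U i w)) @ \oo --> h k (lift w).
  by apply: continuous_cvg; [exact: dual_continuous|exact: lift_cvg].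
have c2 : (fun i => h k (U i w)) @ \oo --> w k.
  by apply: cvg_near_cst; exists k.+1 => // i /= ki; rewrite partial_liftK.
exact: (cvg_unique (@Rhausdorff R) c1 c2).
Qed.

(** The lower bound comes from reading the coordinates back by contractions, the upper one from the
    norms [1 + eps i] of the stages tending to 1. *)
Lemma lift_isometric : isometric lift.
Proof.
move=> w; apply/le_anti/andP; split; last first.
  apply: cseq_norm_le => k; rewrite -(liftK w k); exact: h_le.
apply/ler_addgt0Pr => e e0.
have w0 : 0 < `|w| + e / 2 by rewrite ltr_wpDl// divr_gt0.
have cn : (fun i => `|U i w|) @ \oo --> `|lift w| by apply: cvg_norm; exact: lift_cvg.
rewrite -(cvg_lim (@Rhausdorff R) cn).
apply: limr_le; first by apply/cvg_ex; eexists; exact: cn.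
have half1 : `|(2 : R)^-1| < 1 by rewrite gtr0_norm; lra.
have e1 : 0 < (e / 2) / (`|w| + e / 2) by rewrite !divr_gt0.
have /cvgrPdist_le/(_ _ e1) [i0 _ i0P] := cvg_expr half1.
exists i0 => // i /= ii.
have := i0P _ ii; rewrite /= sub0r normrN exprVn ger0_norm ?invr_ge0 ?exprn_ge0//.
rewrite ler_pdivlMr// => d.
have wj j : (j < i)%N -> `|w j| <= `|w| + e / 2.
  by move=> _; rewrite (le_trans (W_coord_le w j))// lerDl; lra.
rewrite (le_trans (partial_lift_le i w _ w0 wj))//.
have := eps_le i; rewrite -(ler_pM2r w0); move: d; rewrite mulrDl; lra.
Qed.

Lemma coordinates_in_W z : exists w : W alpha, forall k, w k = h k z.
Proof.
have hc : cvgn (fun k => h k z) by apply/cvg_ex; eexists; exact: h_cvg.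
pose hz : cseq R := @CSeq R (fun k => h k z) (mem_set hc).
have hzW : hz \in @W_pred R alpha.
  by rewrite inE; apply: cvg_lim => //; exact: h_cvg.
by exists (MkW hzW).
Qed.

(** The coordinate map [Q] is a contractive left inverse of the isometry [lift], so [lift \o Q] is a
    contractive projection onto the range of [lift]. *)
Lemma lift_one_complemented : contains_one_complemented_copy X (W alpha).
Proof.
have [Q QP] := choice coordinates_in_W.
have W_eq (v w : W alpha) : (forall k, v k = w k) -> v = w.
  by move=> vw; do 2 apply/val_inj; apply/funext.
have Qlin : linear Q.
  move=> a y z; apply: W_eq => k.
  rewrite -[RHS]/(a * Q y k + Q z k) !QP; exact: dual_scalar.
have QK w : Q (lift w) = w by apply: W_eq => k; rewrite QP liftK.
pose T : {linear W alpha -> X} :=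
  HB.pack lift (GRing.isLinear.Build R (W alpha) X *:%R lift lift_linear).
have Plin : linear (lift \o Q) by move=> a y z; rewrite /= Qlin lift_linear.
pose P : {linear X -> X} :=
  HB.pack (lift \o Q) (GRing.isLinear.Build R X X *:%R (lift \o Q) Plin).
exists T; first exact: lift_isometric.
exists P; split.
- by apply/funext => z /=; rewrite QK.
- move=> z; rewrite /= lift_isometric; apply: cseq_norm_le => k.
  by rewrite -[X in `|X|]/(Q z k) QP.
- apply/seteqP; split=> _ [z _ <-]; first by exists (Q z).
  by exists (lift z) => //=; rewrite QK.
Qed.

End lifting.

(** * Subsequences and the weak* topology *)

Section subsequence.
Context {R : realType} (n : nat -> nat) (n_incr : increasing_seq n).

Lemma increasing_seq_leq i j : (n i <= n j)%N = (i <= j)%N.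
Proof. exact: n_incr. Qed.

Lemma increasing_seq_ltn i j : (n i < n j)%N = (i < j)%N.
Proof. by rewrite !ltnNge increasing_seq_leq. Qed.

Lemma increasing_seq_inj : injective n.
Proof.
move=> i j e; have := increasing_seq_ltn i j; have := increasing_seq_ltn j i.
rewrite e ltnn => /esym ji /esym ij; lia.
Qed.

Lemma increasing_seq_ge k : (k <= n k)%N.
Proof.
elim: k => // k IHk; rewrite (leq_ltn_trans IHk)//.
by rewrite increasing_seq_ltn.
Qed.

Lemma increasing_seq_cvgny : n @ \oo --> \oo.
Proof.
move=> A [N _ NA]; exists N => // k /= Nk; apply: NA => /=.
exact: leq_trans Nk (increasing_seq_ge k).
Qed.

(** Among the indices below [n K], only the [n k] with [k < K] can carry nonzero terms. *)
Lemma series_subseq (F : nat -> R) K : (forall i, F i != 0 -> range n i) ->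
  series (F \o n) K = series F (n K).
Proof.
move=> F0; have F0' i : (forall k, n k != i) -> F i = 0.
  move=> ni; apply/eqP; apply: contrapT => /negP /F0[k _ nk].
  by have := ni k; rewrite nk eqxx.
rewrite /series /=; elim: K => [|K IHK].
  rewrite big_geq// big_nat big1// => i /andP[_ i0]; apply: F0' => k.
  by rewrite gtn_eqF// (leq_trans i0)// increasing_seq_leq.
rewrite big_nat_recr//= IHK.
have nK : (n K < n K.+1)%N by rewrite increasing_seq_ltn.
rewrite [RHS](big_cat_nat (leq0n (n K)) (ltnW nK))/=.
congr (_ + _); rewrite big_ltn//.
rewrite big_nat big1 ?addr0// => i /andP[Ki iK]; apply: F0' => k.
have [kK|Kk] := leqP k K.
  by rewrite ltn_eqF// (leq_ltn_trans _ Ki)// increasing_seq_leq.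
by rewrite gtn_eqF// (leq_trans iK)// increasing_seq_leq.
Qed.

End subsequence.

(** The two initial topologies and the pointwise one are unfolded by composing with their continuous
    defining maps, ending with evaluation at [x]. *)
Lemma sigma_ell1_cvg {R : realType} {X : normedModType R}
    (J : dual X -> ell1 R) (u : nat -> ell1 R) (v : ell1 R) :
  (fun k => u k : sigma_ell1 J) @ \oo --> (v : sigma_ell1 J) ->
  forall x, (fun k => 'pinv_(fun=> 0) setT J (u k) x) @ \oo -->
    'pinv_(fun=> 0) setT J v x.
Proof.
move=> uv x.
have c1 := @initial_continuous _ _ ('pinv_(fun=> 0) setT J : ell1 R -> weak_star X).
have c2 := @initial_continuous _ _ (@dual_val R X : dual X -> {ptws X -> R}).
have c3 := cvg_comp _ _ uv (c1 v).
have c4 := cvg_comp _ _ c3 (c2 _).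
exact: (cvg_comp _ _ c4 (@proj_continuous X (fun=> R) x _)).
Qed.

Theorem proposition3p1 (R : realType) (X : completeNormedModType R)
    (J : {linear dual X -> ell1 R})
    (J_isometric : isometric J) (J_onto : range J = [set: ell1 R])
    (n : nat -> nat) (n_incr : increasing_seq n) (estar : ell1 R)
    (e_cvg : (fun k => ell1_basis (n k) : sigma_ell1 J) @ \oo
             --> (estar : sigma_ell1 J))
    (e_supp : supp estar `<=` range n) :
  `|ell1_subseq n_incr estar| <= 1 /\
  contains_one_complemented_copy X (W (ell1_subseq n_incr estar)).
Proof.
pose f i : dual X := 'pinv_(fun=> 0) setT J (ell1_basis i).
pose fstar : dual X := 'pinv_(fun=> 0) setT J estar.
have pinvJ u : J ('pinv_(fun=> 0) setT J u) = u.
  by apply: pinvK; rewrite J_onto inE.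
have Jf i : J (f i) = ell1_basis i by exact: pinvJ.
have f_cvg z : (fun k => f (n k) z) @ \oo --> fstar z.
  exact: (sigma_ell1_cvg J _ _ e_cvg z).
have f_le k z : `|f (n k) z| <= `|z| by exact: (predual_basis_le J J_isometric f Jf).
pose alpha := ell1_subseq n_incr estar.
(* The support condition makes the reindexed series a subsequence of the expansion of [fstar] at
   [z], so its sum is the weak* limit [fstar z]. *)
have h_cvg z : (fun k => f (n k) z) @ \oo -->
    limn (series (fun k => alpha k * f (n k) z)).
  suff -> : limn (series (fun k => alpha k * f (n k) z)) = fstar z by exact: f_cvg.
  apply: cvg_lim => //.
  rewrite (_ : series _ = series (fun i => estar i * f i z) \o n).
    apply: cvg_comp; first exact: increasing_seq_cvgny.
    rewrite -(pinvJ estar); exact: (dual_expansion J J_isometric f Jf).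
  apply/funext => K; rewrite [RHS]/comp -(series_subseq n n_incr)// => i.
  by rewrite mulf_eq0 negb_or => /andP[/e_supp].
split.
  (* The norm of [alpha] is at most that of [estar], which equals that of [fstar], a pointwise limit
     of contractions. *)
  apply: ell1_norm_le => N.
  apply: (@le_trans _ _ `|fstar|).
    rewrite -J_isometric pinvJ (le_trans _ (ell1_norm_ge estar (n N)))//.
    rewrite -[leLHS]/(series ((fun i => `|estar i|) \o n) N) (series_subseq n n_incr)//.
    by move=> i; rewrite normr_eq0 => /e_supp.
  apply: dual_norm_le => z z1.
  have cn : (fun k => `|f (n k) z|) @ \oo --> `|fstar z|.
    by apply: cvg_norm; exact: f_cvg.
  rewrite -(cvg_lim (@Rhausdorff R) cn).
  apply: limr_le; first by apply/cvg_ex; eexists; exact: cn.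
  by apply: nearW => k; rewrite (le_trans (f_le k z)).
have eps0 m : 0 < (16 * m.+1%:R * 2 ^+ m)^-1 :> R.
  by rewrite invr_gt0 !mulr_gt0// exprn_gt0.
have [x [ax sx]] := almost_lift_sequence J J_isometric f Jf n
  (increasing_seq_inj n n_incr) _ eps0.
apply: (lift_one_complemented (fun k => f (n k)) f_le x) => //.
- by move=> m; have [] := ax m.
- by move=> m; have [] := ax m.
Qed.
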